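(* Let $p(x)\in\mathbb{F}_q[x]$ be a primitive polynomial of degree $n$, $\alpha\in\mathbb{F}_{q^n}$ a root of $p(x)$, and $P$ the companion matrix of $p(x)$. Let $\mathcal{U}=\{0,u_1,\ldots,u_{q^k-1}\}$ be a $k$-dimensional subspace of $\mathbb{F}_q^n$, where $u_1,\ldots,u_{q^k-1}\in\mathbb{F}_q^n\setminus\{0\}$ are its distinct nonzero elements, and let $b_i\in\mathbb{Z}_{q^n-1}$ be such that $\phi(u_i)=\alpha^{b_i}$ for all $i=1,\ldots,q^k-1$. Let $d$ be the minimal non-negative integer such that every element of the multiset $$D:=\{\{\,b_m-b_l \bmod (q^n-1)\;\mid\; l,m\in\{1,\ldots,q^k-1\},\ l\ne m\,\}\}$$ has multiplicity less than or equal to $q^d-1$. If $d<k$, then the orbit $\{\mathcal{U}P^i\mid i\ge 0\}$ of the group generated by $P$ on $\mathcal{U}$ is an orbit code of cardinality $q^n-1$ and minimum distance $2k-2d$.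
   Context: $p(x)=p_0+p_1x+\cdots+p_{n-1}x^{n-1}+x^n$ is primitive if it is the minimal polynomial of a generator of $\mathbb{F}_{q^n}^*$. Its companion matrix $P\in\mathrm{GL}_n(\mathbb{F}_q)$ is the $n\times n$ matrix with ones on the superdiagonal, last row $(-p_0,-p_1,\ldots,-p_{n-1})$ and zeros elsewhere. Matrices act on row vectors from the right, and $\mathcal{U}A=\{vA\mid v\in\mathcal{U}\}$. The map $\phi:\mathbb{F}_q^n\to\mathbb{F}_{q^n}$ is $(v_0,\ldots,v_{n-1})\mapsto\sum_{i=0}^{n-1}v_i\alpha^i$. The subspace distance is $d(\mathcal{V},\mathcal{W})=\dim\mathcal{V}+\dim\mathcal{W}-2\dim(\mathcal{V}\cap\mathcal{W})$, and the minimum distance of a code (a set of subspaces) is the smallest distance between two distinct elements. Double braces denote multisets. *)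

(* Defs.v *)
From HB Require Import structures.
From mathcomp Require Import all_boot all_order all_algebra all_fingroup.
From mathcomp Require Import all_solvable all_field.
From mathcomp Require Import finmap multiset.
From mathcomp Require Import boolp classical_sets cardinality.

Set Implicit Arguments.
Unset Strict Implicit.
Unset Printing Implicit Defensive.

Import GRing.Theory.
Local Open Scope mset_scope.
Local Open Scope ring_scope.

(* The field F_{q^n} is an extension L of F = F_q. The alias [finvect_type L]
   is L with its finite-field structure; its group of units is L^*. The
   minimal polynomial of g over F is [minPoly 1 g], a polynomial over L with
   coefficients in the image of F. *)
Definition primitive_polynomial (F : finFieldType) (L : fieldExtType F)
    (p : {poly F}) : Prop :=
  exists2 g : {unit (finvect_type L)},
    generator [set: {unit (finvect_type L)}] g
    & map_poly (in_alg L) p = minPoly 1%AS (FinRing.uval g : L).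

Definition phi (F : finFieldType) (L : fieldExtType F) (n : nat) (alpha : L)
    (v : 'rV[F]_n) : L :=
  \sum_(i < n) v 0 i *: alpha ^+ i.

Definition subspace_mul (F : fieldType) (n : nat) (U : {vspace 'rV[F]_n})
    (A : 'M[F]_n) : {vspace 'rV[F]_n} :=
  (linfun (mulmxr A) @: U)%VS.

Definition orbit_code (F : fieldType) (n : nat) (P : 'M[F]_n)
    (U : {vspace 'rV[F]_n}) : set {vspace 'rV[F]_n} :=
  range (fun i : nat => subspace_mul U (P ^+ i)).

(* The truncated subtraction is exact: \dim (V :&: W) <= \dim V, \dim W. *)
Definition subspace_dist (F : fieldType) (vT : vectType F)
    (V W : {vspace vT}) : nat :=
  (\dim V + \dim W - 2 * \dim (V :&: W)%VS)%N.

(* The minimum is attained, so a code with fewer than two codewords has no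
   minimum distance. *)
Definition has_min_distance (F : fieldType) (vT : vectType F)
    (C : set {vspace vT}) (delta : nat) : Prop :=
  (exists V W, [/\ C V, C W, V <> W & subspace_dist V W = delta]) /\
  (forall V W, C V -> C W -> V <> W -> (delta <= subspace_dist V W)%N).

(* Residues modulo N are represented by int's in [0, N); [modz] returns the
   nonnegative remainder. *)
Definition difference_multiset (M N : nat) (b : 'I_M -> 'I_N) : {mset int} :=
  seq_mset [seq (((b lm.2)%:Z - (b lm.1)%:Z) %% N%:Z)%Z
           | lm <- enum {: 'I_M * 'I_M} & lm.1 != lm.2].

Definition multiplicities_le (K : choiceType) (D : {mset K}) (c : nat) : Prop :=
  forall e : K, e \in D -> (D e <= c)%N.

(* Main.v *)
Require Import Defs.
From HB Require Import structures.
From mathcomp Require Import all_boot all_order all_algebra all_fingroup.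
From mathcomp Require Import all_solvable all_field.
From mathcomp Require Import finmap multiset.
From mathcomp Require Import boolp classical_sets cardinality.

(* Under phi, multiplication by P is multiplication by alpha, which has order
   N = q^n - 1. For 0 < e < N, a pair (l, m) has b_m - b_l = e mod N exactly
   when u_m = u_l P^e, so the multiplicity of e in D counts the nonzero vectors
   of U :&: U P^e: it is q^c - 1 with c = \dim (U :&: U P^e). Hence d is the
   largest such c (d = 0 if D is empty). As d < k, no P^e with 0 < e < N
   stabilizes U; and the distance from U P^i to U P^(i+e) is 2k - 2c because
   P^i is invertible. *)

Set Implicit Arguments.
Unset Strict Implicit.
Unset Printing Implicit Defensive.

Import GRing.Theory.
Local Open Scope ring_scope.

(** * Minimal polynomials and the order of a root of a primitive polynomial *)

Lemma minPoly_root_eq (F : fieldType) (L : fieldExtType F) (K : {subfield L})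
    (x y : L) : root (minPoly K x) y -> minPoly K y = minPoly K x.
Proof.
move=> xy; have dvd_yx := minPoly_dvdp (minPolyOver K x) xy.
have /orP[eq_yx|eq_y1] := minPoly_irr (minPolyOver K y) dvd_yx.
  by apply/eqP; rewrite -eqp_monic ?monic_minPoly.
by have := size_minPoly K y; rewrite (eqp_size eq_y1) size_poly1.
Qed.

(** Elements with the same minimal polynomial over [F] satisfy the same equations X^m = 1, so
    [alpha] has the order of the generator [g], which is the order of the unit group. *)
Lemma primitive_polynomial_prim_root (F : finFieldType) (L : fieldExtType F)
    (p : {poly F}) (alpha : L) :
  primitive_polynomial L p -> root (map_poly (in_alg L) p) alpha ->
  (#|F| ^ \dim {:L} - 1).-primitive_root alpha.
Proof.
case=> g gen_g ->; set x : L := FinRing.uval g => min_root.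
set N := (_ - 1)%N.
have gN : #[g]%g = N.
  rewrite orderE -(eqP gen_g) card_finField_unit -subn1 /N; congr (_ - 1)%N.
  transitivity #|{: finvect_type L}%VS|; first exact/esym/card_vspacef.
  exact: card_vspace.
have xm1 m : (x ^+ m == 1) = (N %| m)%N.
  by rewrite -gN order_dvdn -val_eqE FinRing.val_unitX.
have Xm1_over (m : nat) : ('X^m - 1 : {poly L}) \is a polyOver 1%VS.
  by rewrite rpredB ?rpredX ?polyOverX ?rpred1.
have eq1 m : (alpha ^+ m == 1) = (x ^+ m == 1).
  have root1 (y : L) : root ('X^m - 1) y = (y ^+ m == 1).
    by rewrite rootE !hornerE subr_eq0.
  have minP (y : L) : (minPoly 1%AS y %| 'X^m - 1) = root ('X^m - 1) y.
    apply/idP/idP => [/dvdpP[r ->]|]; last exact: minPoly_dvdp.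
    by rewrite rootM root_minPoly orbT.
  by rewrite -!root1 -!minP (minPoly_root_eq min_root).
have N_gt0 : (0 < N)%N by rewrite -gN order_gt0.
have aN : alpha ^+ N = 1 by apply/eqP; rewrite eq1 xm1.
(* The order [m] of [alpha] divides [N]; conversely alpha^m = 1 carries over to [x], whose order is
   [N]. *)
have [m pm mN] := prim_order_exists N_gt0 aN.
have /eqP -> // : N == m.
by rewrite eqn_dvd mN -xm1 -eq1 (prim_expr_order pm) eqxx.
Qed.

(** * The map [phi] and the companion matrix *)

Lemma phi_inj (F : finFieldType) (L : fieldExtType F) (n : nat) (alpha : L) :
  (n < size (minPoly 1%AS alpha))%N -> injective (@phi F L n alpha).
Proof.
move=> n_lt v w eq_vw; apply/eqP; rewrite -subr_eq0; apply/eqP.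
(* [r] has size at most [n] and vanishes at [alpha]; the minimal polynomial divides it but is
   larger, which forces [r] to be zero. *)
pose r := map_poly (in_alg L) (rVpoly (v - w)).
have sz_r : (size r <= n)%N by rewrite size_map_poly size_poly.
have r0 : r = 0.
  apply/eqP; rewrite -size_poly_eq0 -leqn0 leqNgt size_poly_gt0.
  apply/negP => nz_r.
  have /(dvdp_leq nz_r) : minPoly 1%AS alpha %| r.
    apply: minPoly_dvdp.
      by apply/polyOver1P; exists (rVpoly (v - w)).
    rewrite rootE (horner_coef_wide _ sz_r) -[X in _ == X](subrr (phi alpha v)).
    rewrite [X in _ - X]eq_vw -sumrB; apply/eqP/eq_bigr => i _.
    by rewrite coef_map /= coef_rVpoly_ord !mxE -scalerBl mulr_algl.
  by rewrite leqNgt (leq_ltn_trans sz_r).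
apply: (can_inj rVpolyK); rewrite linear0.
by apply/eqP; rewrite -(map_poly_eq0 (in_alg L)) -/r r0.
Qed.

Lemma phi_companion (F : finFieldType) (L : fieldExtType F) (p : {poly F})
    (n : nat) (hdeg : (size p).-1 = n) (alpha : L) (v : 'rV[F]_n) :
  p \is monic -> root (map_poly (in_alg L) p) alpha ->
  phi alpha (v *m castmx (hdeg, hdeg) (companionmx p)) = alpha * phi alpha v.
Proof.
move: v; case: n / hdeg => v mon_p; rewrite castmx_id.
have sz_p : size p = (size p).-1.+1.
  by rewrite prednK // lt0n size_poly_eq0 monic_neq0.
rewrite rootE (horner_coef_wide (n := (size p).-1.+1)); last first.
  by rewrite size_map_poly -sz_p.
(* As [p] is monic, its root [alpha] has its top power expressed by the lower ones; this is [top],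
   used for the last row. *)
rewrite big_ord_recr coef_map /= -lead_coefE (monicP mon_p) scale1r mul1r.
rewrite addrC addr_eq0 => /eqP top.
rewrite /phi mulr_sumr; under eq_bigr do rewrite mxE scaler_suml.
rewrite exchange_big; apply: eq_bigr => i _ /=.
rewrite -scalerAr -exprS; under eq_bigr do rewrite -scalerA.
rewrite -scaler_sumr; congr (_ *: _).
(* What remains is that row [i] represents alpha^(i+1): the last row by [top], every other row
   because it is the unit vector of index [i.+1]. *)
have [i_top|i_lt] := eqVneq (i : nat) (size p).-1.-1.
  have -> : i.+1 = (size p).-1.
    by move/(congr1 succn): i_top => ->; apply: ltn_predK (ltn_ord i).
  rewrite top -sumrN; apply: eq_bigr => j _.
  by rewrite mxE (introT eqP i_top) coef_map /= mulr_algl scaleNr.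
have lt_i : (i.+1 < (size p).-1)%N.
  rewrite ltn_neqAle ltn_ord andbT.
  by apply: contraNneq i_lt => /(congr1 predn) /eqP.
rewrite (bigD1 (Ordinal lt_i)) //= big1 => [|j ne_j]; last first.
  by rewrite mxE (negPf i_lt) eq_sym [_ == _](negPf ne_j) scale0r.
by rewrite mxE (negPf i_lt) eqxx scale1r addr0.
Qed.

(** * The action of matrices on subspaces *)

Lemma memv_subspace_mul (F : fieldType) (n : nat) (U : {vspace 'rV[F]_n})
    (A : 'M[F]_n) (v : 'rV[F]_n) :
  reflect (exists2 w, w \in U & v = w *m A) (v \in subspace_mul U A).
Proof.
apply: (iffP memv_imgP) => -[w Uw ->]; exists w => //;
by rewrite lfunE.
Qed.

Lemma subspace_mul1 (F : fieldType) (n : nat) (U : {vspace 'rV[F]_n}) :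
  subspace_mul U 1 = U.
Proof.
apply/vspaceP => v; apply/memv_subspace_mul/idP => [[w Uw ->]|Uv].
  by rewrite mulmx1.
by exists v; rewrite ?mulmx1.
Qed.

Lemma subspace_mulM (F : fieldType) (n : nat) (U : {vspace 'rV[F]_n})
    (A B : 'M[F]_n) :
  subspace_mul U (A * B) = subspace_mul (subspace_mul U A) B.
Proof.
apply/vspaceP => v; apply/memv_subspace_mul/memv_subspace_mul.
  case=> w Uw ->; exists (w *m A); last by rewrite -mulmxA.
  by apply/memv_subspace_mul; exists w.
by case=> _ /memv_subspace_mul[w Uw ->] ->; exists w; rewrite -?mulmxA.
Qed.

Lemma lker0_mulmxr (F : fieldType) (n : nat) (A B : 'M[F]_n) :
  A * B = 1 -> lker (linfun (mulmxr A) : 'Hom('rV[F]_n, 'rV[F]_n)) == 0%VS.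
Proof.
move=> AB1; apply/lker0P => v w; rewrite !lfunE /= => /(congr1 (mulmx^~ B)).
by rewrite -!mulmxA [A *m B]AB1 !mulmx1.
Qed.

Lemma dim_subspace_mul (F : fieldType) (n : nat) (U : {vspace 'rV[F]_n})
    (A B : 'M[F]_n) : A * B = 1 -> \dim (subspace_mul U A) = \dim U.
Proof.
by move=> /lker0_mulmxr/eqP kerA; rewrite limg_dim_eq // kerA capv0.
Qed.

Lemma dim_subspace_mul_cap (F : fieldType) (n : nat)
    (U V : {vspace 'rV[F]_n}) (A B : 'M[F]_n) : A * B = 1 ->
  \dim (subspace_mul U A :&: subspace_mul V A) = \dim (U :&: V).
Proof.
move=> AB1; rewrite /subspace_mul -lker0_img_cap ?(lker0_mulmxr AB1) //.
exact: dim_subspace_mul AB1.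
Qed.

(** * Orbits of a matrix of finite order whose nontrivial translates of [U] meet [U] in dimension at
    most [d] *)

Section CyclicOrbit.

Variables (F : fieldType) (n : nat) (P : 'M[F]_n) (U : {vspace 'rV[F]_n}).
Variables (N d : nat).
Hypotheses (N_gt0 : (0 < N)%N) (PN1 : P ^+ N = 1) (d_lt : (d < \dim U)%N).
Hypothesis cap_le : forall e, (0 < e < N)%N ->
  (\dim (U :&: subspace_mul U (P ^+ e)) <= d)%N.

(** The exponent [i * N - i] represents -i modulo [N] within [nat]; the subtraction is exact since
    [N] is positive. *)
Let expP_inv i : P ^+ i * P ^+ (i * N - i) = 1.
Proof. by rewrite -exprD subnKC ?leq_pmulr // mulnC exprM PN1 expr1n. Qed.

Let expP_mod i : P ^+ (i %% N) = P ^+ i.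
Proof. by rewrite [in RHS](divn_eq i N) exprD mulnC exprM PN1 expr1n mul1r. Qed.

Lemma cyclic_orbit_neq e : (0 < e < N)%N -> subspace_mul U (P ^+ e) <> U.
Proof.
move=> /cap_le; rewrite leqNgt => /negP cap eqU.
by apply: cap; rewrite eqU capvv.
Qed.

(** Taking [e] as the residue of j - i reduces any pair of codewords to the pair [U], [U P^e], moved
    by the invertible [P ^+ i]. *)
Lemma cyclic_orbit_shift i j : exists2 e, (e < N)%N &
  subspace_mul U (P ^+ j) = subspace_mul (subspace_mul U (P ^+ e)) (P ^+ i).
Proof.
exists ((j + (i * N - i)) %% N)%N; first by rewrite ltn_mod.
rewrite -subspace_mulM expP_mod -exprD -addnA subnK ?leq_pmulr // exprD.
by rewrite [(i * N)%N]mulnC [P ^+ (N * i)]exprM PN1 expr1n mulr1.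
Qed.

Lemma card_cyclic_orbit_code : (orbit_code P U #= `I_N)%card.
Proof.
have -> : orbit_code P U = [set subspace_mul U (P ^+ i) | i in `I_N]%classic.
  apply/seteqP; split => V [i].
    by move=> _ <-; exists (i %% N)%N; rewrite /= ?ltn_mod ?expP_mod.
  by move=> _ <-; exists i.
apply: inj_card_eq => i j; rewrite !inE /= => i_lt j_lt eq_ij.
wlog lt_ij : i j i_lt j_lt eq_ij / (i < j)%N.
  by case: (ltngtP i j) => // /[swap] H /H -> //.
have e_int : (0 < j - i < N)%N.
  by rewrite subn_gt0 lt_ij (leq_ltn_trans (leq_subr _ _)).
(* Cancelling [P ^+ i] in the equality of codewords would make [P ^+ (j - i)] stabilize [U]. *)
case: (cyclic_orbit_neq e_int); apply/vspaceP => v.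
have mulK (V : {vspace 'rV[F]_n}) :
    subspace_mul (subspace_mul V (P ^+ i)) (P ^+ (i * N - i)) = V.
  by rewrite -subspace_mulM expP_inv subspace_mul1.
have eq_i : subspace_mul (subspace_mul U (P ^+ (j - i))) (P ^+ i)
    = subspace_mul U (P ^+ i).
  by rewrite -subspace_mulM -exprD (subnK (ltnW lt_ij)).
by rewrite -(mulK (subspace_mul U (P ^+ (j - i)))) eq_i mulK.
Qed.

Lemma cyclic_orbit_min_distance e : (0 < e < N)%N ->
  \dim (U :&: subspace_mul U (P ^+ e)) = d ->
  has_min_distance (orbit_code P U) (2 * \dim U - 2 * d).
Proof.
move=> e_int cap_e; split.
  exists (subspace_mul U (P ^+ 0)), (subspace_mul U (P ^+ e)).
  rewrite expr0 subspace_mul1; split.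
  - by exists 0%N; rewrite ?expr0 ?subspace_mul1.
  - by exists e.
  - by move/esym; apply: cyclic_orbit_neq.
  - rewrite /subspace_dist cap_e (dim_subspace_mul _ (expP_inv e)).
    by rewrite addnn -mul2n.
move=> _ _ [i _ <-] [j _ <-].
have [f f_lt ->] := cyclic_orbit_shift i j => ne_ij.
rewrite /subspace_dist (dim_subspace_mul_cap _ _ (expP_inv i)).
rewrite !(dim_subspace_mul _ (expP_inv _)) addnn -mul2n.
(* The bound [cap_le] applies because [f] is nonzero: the two codewords differ. *)
rewrite leq_sub2l // leq_mul2l /= cap_le // f_lt andbT lt0n.
by apply/eqP => f0; apply: ne_ij; rewrite f0 expr0 subspace_mul1.
Qed.

End CyclicOrbit.

(** Moving [y] to the other side turns the integer residue into a congruence of naturals, the form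
    in which equality of powers of a primitive root is stated. *)
Lemma subz_modzE (x y N e : nat) : (e < N)%N ->
  (((x%:Z - y%:Z) %% N%:Z)%Z == e%:Z) = (x == e + y %[mod N])%N.
Proof.
move=> e_lt; rewrite -[e%:Z in LHS](modz_small (d := N)) ?lez_nat //.
by rewrite -(eqz_modDr y) subrK -PoszD !modz_nat.
Qed.

(** * Multiplicities of differences as sizes of intersections *)

Section Differences.

Variables (F : finFieldType) (L : fieldExtType F) (n M N : nat).
Variables (alpha : L) (P : 'M[F]_n) (U : {vspace 'rV[F]_n}).
Variables (u : 'I_M -> 'rV[F]_n) (b : 'I_M -> 'I_N).
Hypothesis prim_alpha : N.-primitive_root alpha.
Hypothesis phi_alpha_inj : injective (@phi F L n alpha).
Hypothesis phiP : forall v : 'rV[F]_n, phi alpha (v *m P) = alpha * phi alpha v.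
Hypothesis u_inj : injective u.
Hypothesis u_neq0 : forall i, u i != 0.
Hypothesis uU : forall v : 'rV[F]_n, v \in U <-> v = 0 \/ exists i, v = u i.
Hypothesis phi_u : forall i, phi alpha (u i) = alpha ^+ b i.

Lemma phi_expP (v : 'rV[F]_n) (i : nat) :
  phi alpha (v *m P ^+ i) = alpha ^+ i * phi alpha v.
Proof.
elim: i v => [|i IHi] v; first by rewrite !expr0 mulmx1 mul1r.
by rewrite exprSr mulmxA phiP IHi mulrA -exprS.
Qed.

Lemma expP_eq1 : P ^+ N = 1.
Proof.
apply/row_matrixP => i; rewrite !rowE; apply: phi_alpha_inj.
by rewrite phi_expP (prim_expr_order prim_alpha) mul1r mulmx1.
Qed.

Lemma mulmx_expP_eq (l m : 'I_M) (e : nat) :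
  (u m == u l *m P ^+ e) = (b m == e + b l %[mod N])%N.
Proof.
rewrite -(inj_eq phi_alpha_inj) phi_expP !phi_u -exprD.
exact: eq_prim_root_expr.
Qed.

Lemma difference_multisetE (e : nat) : (0 < e < N)%N ->
  difference_multiset b e%:Z =
  (#|F| ^ \dim (U :&: subspace_mul U (P ^+ e)) - 1)%N.
Proof.
case/andP=> e_gt0 e_lt; set V := (U :&: _)%VS.
(* The restriction to distinct indices in the multiset loses no pair, since [e] is nonzero modulo
   [N]. *)
have lt_u m l : u m = u l *m P ^+ e -> l != m.
  move/eqP; rewrite mulmx_expP_eq => eq_ml; apply/eqP => lm; move: eq_ml.
  rewrite lm -[in X in X == _](add0n (b m)) eqn_modDr mod0n modn_small //.
  by rewrite eq_sym eqn0Ngt e_gt0.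
rewrite /difference_multiset mset_seqE count_map count_filter.
rewrite -(card_vspace V) (cardD1 0) mem0v add1n subn1 /=.
pose A := [set lm : 'I_M * 'I_M | u lm.2 == u lm.1 *m P ^+ e].
transitivity #|A|.
  rewrite cardE /enum_mem size_filter count_filter -enumT.
  apply: eq_count => -[l m] /=.
  rewrite !inE andbT subz_modzE // -mulmx_expP_eq /=.
  by case: eqP => // /lt_u ->.
have P_inj (v w : 'rV[F]_n) : v *m P ^+ e = w *m P ^+ e -> v = w.
  move=> /(congr1 (mulmx^~ (P ^+ (N - e)))) /=.
  have PK : P ^+ e * P ^+ (N - e) = 1.
    by rewrite -exprD (subnKC (ltnW e_lt)) expP_eq1.
  by rewrite -!mulmxA [P ^+ e *m _]PK !mulmx1.
(* The pair (l, m) corresponds to the nonzero vector [u m] of the intersection; [l] is recovered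
   from [m] by cancelling [P ^+ e]. *)
rewrite -(card_in_imset (f := fun lm => u lm.2) (D := A)).
  apply: eq_card => v; rewrite !inE; apply/imsetP/andP => [[[l m]]|[nz_v]].
    rewrite inE /= => /eqP ml ->; split; first exact: u_neq0.
    rewrite memv_cap; apply/andP; split; first by apply/uU; right; exists m.
    by apply/memv_subspace_mul; exists (u l) => //; apply/uU; right; exists l.
  rewrite memv_cap => /andP[/uU[v0|[m vm]]]; first by rewrite v0 eqxx in nz_v.
  move=> /memv_subspace_mul[w /uU[->|[l ->]]] vw.
    by rewrite vw mul0mx eqxx in nz_v.
  by exists (l, m); rewrite // inE /= -vm vw.
move=> [l m] [l' m'] /=; rewrite !inE /= => /eqP ml /eqP ml' mm'.
rewrite (u_inj mm') (u_inj (x1 := l) (x2 := l')) //.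
by apply: P_inj; rewrite -ml -ml'.
Qed.

(** Residue 0 cannot occur: it would give [u l] and [u m] the same image under [phi], hence l =
    m. *)
Lemma difference_multiset_int (x : int) : x \in difference_multiset b ->
  exists2 e : nat, (0 < e < N)%N & x = e%:Z.
Proof.
rewrite (perm_mem (perm_eq_seq_mset _)) => /mapP[[l m]].
rewrite mem_filter /= => /andP[ne_lm _] ->.
have N_gt0 := prim_order_gt0 prim_alpha.
have nz_N : N%:Z != 0 by rewrite eqz_nat -lt0n.
set x0 := (_ %% _)%Z; have := modz_ge0 ((b m)%:Z - (b l)%:Z) nz_N.
have := ltz_pmod ((b m)%:Z - (b l)%:Z) (d := N%:Z) N_gt0.
rewrite -/x0; case Dx: x0 => [e|//]; rewrite ltz_nat => e_lt _.
exists e => //; rewrite e_lt andbT lt0n; apply: contraNneq ne_lm => e0.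
apply/eqP; apply: u_inj; apply: phi_alpha_inj; rewrite !phi_u; apply/eqP.
rewrite (eq_prim_root_expr prim_alpha) eq_sym -[X in _ == X %[mod _]]add0n -e0.
by rewrite -subz_modzE // -/x0 Dx.
Qed.

End Differences.

(** If q^n - 1 = 1, the orbit has a single codeword and so no minimum distance; hence the premise of
    the second conjunct. *)
Theorem theorem34 (F : finFieldType) (q : nat) (hq : #|F| = q)
    (n : nat) (L : fieldExtType F) (hL : \dim {:L} = n)
    (p : {poly F}) (hdeg : (size p).-1 = n)
    (hp : primitive_polynomial L p)
    (alpha : L) (halpha : root (map_poly (in_alg L) p) alpha)
    (P : 'M[F]_n) (hP : P = castmx (hdeg, hdeg) (companionmx p))
    (k : nat) (U : {vspace 'rV[F]_n}) (hk : \dim U = k)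
    (u : 'I_(q ^ k - 1) -> 'rV[F]_n)
    (hu_inj : injective u)
    (hu_neq0 : forall i, u i != 0)
    (hU : forall v : 'rV[F]_n, v \in U <-> v = 0 \/ exists i, v = u i)
    (b : 'I_(q ^ k - 1) -> 'I_(q ^ n - 1))
    (hb : forall i, phi alpha (u i) = alpha ^+ b i)
    (d : nat)
    (hd : multiplicities_le (difference_multiset b) (q ^ d - 1))
    (hd_min : forall d' : nat,
       multiplicities_le (difference_multiset b) (q ^ d' - 1) -> (d <= d')%N)
    (hdk : (d < k)%N) :
  (orbit_code P U #= `I_(q ^ n - 1))%card /\
  ((1 < q ^ n - 1)%N -> has_min_distance (orbit_code P U) (2 * k - 2 * d)).
Proof.
have prim_a : (q ^ n - 1).-primitive_root alpha.
  by rewrite -hq -hL; apply: primitive_polynomial_prim_root hp halpha.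
have min_a : map_poly (in_alg L) p = minPoly 1%AS alpha.
  by case: hp halpha => g _ -> /minPoly_root_eq ->.
have mon_p : p \is monic by rewrite -(map_monic (in_alg L)) min_a monic_minPoly.
have phi_a : injective (@phi F L n alpha).
  apply: phi_inj; rewrite -min_a size_map_poly -hdeg ltn_predL.
  by rewrite size_poly_gt0 monic_neq0.
have phiP (v : 'rV[F]_n) : phi alpha (v *m P) = alpha * phi alpha v.
  by rewrite hP phi_companion.
have q_gt1 : (1 < q)%N by rewrite -hq finNzRing_gt1.
have PN1 : P ^+ (q ^ n - 1) = 1 by apply: expP_eq1 prim_a phi_a phiP.
have DE := difference_multisetE prim_a phi_a phiP hu_inj hu_neq0 hU hb.
rewrite hq in DE.
have le_cap e c : (difference_multiset b e%:Z <= q ^ c - 1)%N ->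
    (0 < e < q ^ n - 1)%N ->
    (\dim (U :&: subspace_mul U (P ^+ e)) <= c)%N.
  move=> le_c /DE DEe; move: le_c; rewrite DEe.
  by rewrite -(leq_add2r 1) !subnK ?expn_gt0 ?(ltnW q_gt1) // leq_exp2l.
have cap_le e : (0 < e < q ^ n - 1)%N ->
    (\dim (U :&: subspace_mul U (P ^+ e)) <= d)%N.
  (* If [e] does not occur in the multiset, its multiplicity is 0 and the bound is immediate. *)
  apply: le_cap; case: (boolP (e%:Z \in difference_multiset b)) => [/hd//|].
  by move/mset_eq0P => ->.
have N_gt0 := prim_order_gt0 prim_a.
rewrite -hk in hdk *; split.
  exact: card_cyclic_orbit_code N_gt0 PN1 hdk cap_le.
move=> N_gt1.
suff [e e_int cap_e] : exists2 e, (0 < e < q ^ n - 1)%N &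
    (d <= \dim (U :&: subspace_mul U (P ^+ e)))%N.
  have /eqP cap_d : \dim (U :&: subspace_mul U (P ^+ e)) == d.
    by rewrite eqn_leq cap_e cap_le.
  exact (cyclic_orbit_min_distance N_gt0 PN1 hdk cap_le e_int cap_d).
(* For d = 0 any exponent in range serves, and 1 is in range by [N_gt1]. For d = d' + 1, if no
   intersection reached dimension d, all multiplicities would be at most q^d' - 1, against the
   minimality of d. *)
case: d hd_min {hd hdk cap_le} => [_|d' hd_min]; first by exists 1%N.
apply: contrapT => no_e.
suff /hd_min : multiplicities_le (difference_multiset b) (q ^ d' - 1).
  by rewrite ltnn.
move=> _ /(difference_multiset_int prim_a phi_a hu_inj hb)[e e_int ->].
rewrite DE // leq_sub2r // leq_exp2l // leqNgt; apply/negP => lt_e.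
by apply: no_e; exists e.
Qed.
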